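(* Let $X$ be a Poisson-distributed random finite set (RFS) on $\mathbb{X}$ with probability hypothesis density (PHD, intensity function) $D(\boldsymbol{x})$ and global cardinality mean $N_X$, i.e. with RFS density $f(X)=e^{-N_X}[D]^X$. Then the cardinality of objects inside the field-of-view $\mathcal{S}$ is distributed according to $$\rho_{\mathcal{S}}(n)=\sum_{m=n}^{\infty}\frac{e^{-N_X}}{n!\,(m-n)!}\,\langle 1_{\mathcal{S}},D\rangle^{n}\,\langle 1-1_{\mathcal{S}},D\rangle^{m-n},\qquad n=0,1,2,\dots$$
   Context: $\mathbb{X}$ is the single-object (Euclidean) state space and $\mathbb{X}_{\mathrm p}$ is a subspace of it. The field-of-view (FoV) is a compact subset $\mathcal{S}\subset\mathbb{X}_{\mathrm p}$. For $\boldsymbol{x}\in\mathbb{X}$ write $\boldsymbol{x}_{\mathrm p}=\mathrm{proj}_{\mathbb{X}_{\mathrm p}}\boldsymbol{x}$. The generalized indicator is $1_{\mathcal{S}}(\boldsymbol{x})=1$ if $\boldsymbol{x}_{\mathrm p}\in\mathcal{S}$ and $0$ otherwise (when $\mathbb{X}_{\mathrm p}=\mathbb{X}$ this is the usual indicator of $\mathcal{S}\subseteq\mathbb{X}$). Notation: $h^{A}=[h]^{A}=[h(\cdot)]^{A}=\prod_{a\in A}h(a)$ for a finite set $A$, with $h^{\emptyset}=1$; $\langle f,g\rangle=\int_{\mathbb{X}} f(\boldsymbol{x})g(\boldsymbol{x})\,\mathrm{d}\boldsymbol{x}$. The zeroth power of any number is $1$. The PHD $D\ge 0$ is an integrable function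 on $\mathbb{X}$ whose integral over a set $T$ is the expected number of objects in $T$: $E[|X\cap T|]=\int_T D(\boldsymbol{x})\,\mathrm{d}\boldsymbol{x}$. In particular $N_X=\int_{\mathbb{X}}D(\boldsymbol{x})\,\mathrm{d}\boldsymbol{x}$. FoV cardinality distribution: for a finite set $X\subset\mathbb{X}$, the probability that exactly $n$ objects are inside $\mathcal{S}$ conditioned on $X$ is $$\rho_{\mathcal{S}}(n\,|\,X)=\sum_{X^n\subseteq X,\ |X^n|=n}[1_{\mathcal{S}}(\cdot)]^{X^n}[1-1_{\mathcal{S}}(\cdot)]^{X\setminus X^n}.$$ For an RFS with density $f$, the FoV cardinality distribution is the set integral $\rho_{\mathcal{S}}(n)=\int\rho_{\mathcal{S}}(n\,|\,X)f(X)\,\delta X$, that is $$\rho_{\mathcal{S}}(n)=\sum_{m=n}^{\infty}\frac{1}{m!}\int_{\mathbb{X}^m}\rho_{\mathcal{S}}(n\,|\,\{\boldsymbol{x}_1,\dots,\boldsymbol{x}_m\})\,f(\{\boldsymbol{x}_1,\dots,\boldsymbol{x}_m\})\,\mathrm{d}\boldsymbol{x}_1\cdots\mathrm{d}\boldsymbol{x}_m.$$ *)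

(* Defs.v *)
From HB Require Import structures.
From mathcomp Require Import all_boot all_order all_algebra finmap.
From mathcomp Require Import all_classical all_reals all_analysis.
From mathcomp Require Import measurable_realfun lra.

Set Implicit Arguments.
Unset Strict Implicit.
Unset Printing Implicit Defensive.

Import Order.TTheory GRing.Theory Num.Theory.
Import numFieldNormedType.Exports.

Local Open Scope classical_set_scope.
Local Open Scope ring_scope.

Lemma pushforward_sigma_finite d1 d2 (T1 : measurableType d1)
    (T2 : measurableType d2) (R : realType) (m : set T1 -> \bar R)
    (f : T1 -> T2) (g : T2 -> T1) :
  measurable_fun [set: T2] g -> cancel f g ->
  sigma_finite setT m -> sigma_finite setT (pushforward m f).
Proof.
move=> mg fK [F FT Ffin]; exists (fun i => g @^-1` F i).
  by rewrite -preimage_bigcup -FT preimage_setT.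
move=> i; have [mF Foo] := Ffin i; split.
  by rewrite -[X in measurable X]setTI; exact: mg.
rewrite /pushforward (_ : f @^-1` _ = F i)//.
by apply/seteqP; split => x /=; rewrite fK.
Qed.

(* The library instance is shadowed by the one for subprobabilities. *)
Lemma product_sigma_finite d1 d2 (T1 : measurableType d1)
    (T2 : measurableType d2) (R : realType)
    (m1 : {sigma_finite_measure set T1 -> \bar R})
    (m2 : {sigma_finite_measure set T2 -> \bar R}) :
  sigma_finite setT (product_measure1 m1 m2).
Proof.
have /sigma_finiteP[F [TF ndF Foo]] := sigma_finiteT m1.
have /sigma_finiteP[G [TG ndG Goo]] := sigma_finiteT m2.
exists (fun n => F n `*` G n).
  rewrite -setXTT TF TG predeqE => -[x y]; split => [|[n _ []/= ? ?]].
    move=> [/= [n _ Fnx] [k _ Gky]]; exists (maxn n k) => //; split.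
    - by move: x Fnx; exact/subsetPset/ndF/leq_maxl.
    - by move: y Gky; exact/subsetPset/ndG/leq_maxr.
  by split; exists n.
move=> k; have [? ?] := Foo k; have [? ?] := Goo k.
split; first exact: measurableX.
by rewrite product_measure1E// lte_mul_pinfty// ge0_fin_numE.
Qed.

Section power_measure.
Context d (T : measurableType d) (R : realType).

Definition cons_tuple n (p : T * n.-tuple T) : n.+1.-tuple T :=
  [tuple of p.1 :: p.2].

Definition uncons_tuple n (t : n.+1.-tuple T) : T * n.-tuple T :=
  (thead t, [tuple of behead t]).

Lemma cons_tupleK n : cancel (@cons_tuple n) (@uncons_tuple n).
Proof.
move=> [x t]; rewrite /uncons_tuple /cons_tuple theadE; congr pair.
exact/val_inj.
Qed.

Lemma measurable_cons_tuple n : measurable_fun setT (@cons_tuple n).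
Proof. by apply: (measurable_cons (f := fst) (g := snd)). Qed.

Lemma measurable_uncons_tuple n : measurable_fun setT (@uncons_tuple n).
Proof.
apply: measurable_fun_pair; last exact: measurable_behead.
rewrite /thead; exact: measurable_tnth.
Qed.

Section cons_measure.
Variables (m : {sigma_finite_measure set T -> \bar R}) (n : nat).
Variable m' : {sigma_finite_measure set (n.-tuple T) -> \bar R}.

Definition cons_measure : set (n.+1.-tuple T) -> \bar R :=
  pushforward (product_measure1 m m') (@cons_tuple n).

Let mc := @measurable_cons_tuple n.
Hint Resolve mc : core.

Let cons_measure0 : cons_measure set0 = 0%E.
Proof. by rewrite /cons_measure; apply: measure0. Qed.

Let cons_measure_ge0 A : (0 <= cons_measure A)%E.
Proof. by rewrite /cons_measure; apply: measure_ge0. Qed.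

Let cons_measure_sigma_additive : semi_sigma_additive cons_measure.
Proof. by rewrite /cons_measure; apply: measure_semi_sigma_additive. Qed.

HB.instance Definition _ := isMeasure.Build _ _ _ cons_measure
  cons_measure0 cons_measure_ge0 cons_measure_sigma_additive.

Let cons_measure_sigma_finite : sigma_finite setT cons_measure.
Proof.
apply: (pushforward_sigma_finite (@measurable_uncons_tuple n)
  (@cons_tupleK n)).
exact: product_sigma_finite.
Qed.

HB.instance Definition _ := Measure_isSigmaFinite.Build _ _ _ cons_measure
  cons_measure_sigma_finite.

End cons_measure.

(* The n-fold product of m, on the product sigma-algebra of T^n. *)
Fixpoint power_measure (m : {sigma_finite_measure set T -> \bar R}) (n : nat) :
    {sigma_finite_measure set (n.-tuple T) -> \bar R} :=
  match n with
  | 0 => \d_ [tuple]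
  | n'.+1 => cons_measure m (power_measure m n')
  end.

Lemma power_measure_box (m : {sigma_finite_measure set T -> \bar R}) n
    (A : 'I_n -> set T) : (forall i, measurable (A i)) ->
  power_measure m n [set t | forall i, A i (tnth t i)] =
  (\prod_(i < n) m (A i))%E.
Proof.
elim: n A => [|n IH] A mA.
  rewrite big_ord0 /= diracE (_ : _ \in _ = true)//.
  by apply/mem_set => -[].
rewrite big_ord_recl -(IH (fun i => A (lift ord0 i)))//=.
rewrite -product_measure1E//; last first.
  rewrite (_ : mkset _ = \bigcap_(i in [set: 'I_n])
      ((fun t => tnth t i) @^-1` A (lift ord0 i))); last first.
    by apply/seteqP; split => [t H i _|t H i] /=; [exact: H|exact: (H i)].
  apply: fin_bigcap_measurable => // i _.
  by rewrite -[X in measurable X]setTI; exact: measurable_tnth.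
rewrite /cons_measure /pushforward; congr (product_measure1 _ _ _).
apply/seteqP; split => [[x t] /= H|[x t] /= [Ax H] i].
  by split => [|i]; [exact: (H ord0)|have := H (lift ord0 i); rewrite tnthS].
by case: (unliftP ord0 i) => [j|] ->; rewrite ?tnthS//; exact: H.
Qed.

End power_measure.

Section lebesgue_rV.
Context (R : realType).

(* Matrices, hence row vectors, carry their Borel sigma-algebra. *)
HB.instance Definition _ (m n : nat) :=
  @isMeasurable.Build (sigma_display (@open 'M[R]_(m, n))) 'M[R]_(m, n)
    <<s (@open 'M[R]_(m, n)) >> (@sigma_algebra0 _ setT _)
    (@sigma_algebraC _ _) (@sigma_algebra_bigcup _ _ _).

Variable d : nat.

Definition row_of_tuple (t : d.-tuple (measurableTypeR R)) : 'rV[R]_d :=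
  \row_i tnth t i.

Definition tuple_of_row (x : 'rV[R]_d) : d.-tuple (measurableTypeR R) :=
  [tuple x ord0 i | i < d].

Lemma row_of_tupleK : cancel row_of_tuple tuple_of_row.
Proof. by move=> t; apply: eq_from_tnth => i; rewrite tnth_mktuple mxE. Qed.

Lemma measurable_tuple_of_row : measurable_fun setT tuple_of_row.
Proof.
apply/measurable_fun_tnthP => i.
rewrite (_ : _ \o _ = fun x : 'rV[R]_d => x ord0 i); last first.
  by apply/funext => x /=; rewrite tnth_mktuple.
apply: (@measurability _ _ _ (measurableTypeR R) _ _ _
  (RGenOpens.measurableE R)).
move=> _ [_ [a [b ->] <-]]; rewrite setTI; apply: sub_sigma_algebra.
by apply: open_comp; [move=> x _; exact: coord_continuous|exact: interval_open].
Qed.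

Lemma open_rV_bigcup (U : set 'rV[R]_d) : open U ->
  U = \bigcup_(q : 'rV[rat]_d * rat)
    [set x | (0 < (ratr q.2 : R) /\
              ball (map_mx ratr q.1 : 'rV[R]_d) (ratr q.2) `<=` U) /\
             forall i, ball (ratr (q.1 ord0 i) : R) (ratr q.2) (x ord0 i)].
Proof.
move=> oU; apply/seteqP; split => [x Ux|x [[c r] _ /= [[r0 cU] xc]]]; last first.
  by apply: cU; split => // i j; rewrite !mxE (ord1 i); exact: xc.
have /nbhs_ballP[e /= e0 xe] : nbhs x U by exact: open_nbhs_nbhs.
have [r /andP[r0 re]] : exists r : rat, 0 < (ratr r : R) < e / 2.
  have [r] := @rat_in_itvoo R 0 (e / 2) (divr_gt0 e0 (ltr0Sn _ _)).
  by rewrite in_itv/= => H; exists r.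
have : forall i, exists c : rat, `|x ord0 i - ratr c| < ratr r.
  move=> i; have [|c] := @rat_in_itvoo R (x ord0 i) (x ord0 i + ratr r).
    by rewrite ltrDl.
  by rewrite in_itv/= => /andP[xc cx]; exists c; rewrite ltr_norml; lra.
move=> /choice[c Hc].
have cx : ball (map_mx ratr (\row_i c i) : 'rV[R]_d) (ratr r) x.
  by split => // i j; rewrite !mxE (ord1 i) /ball /= distrC; exact: Hc.
exists (\row_i c i, r) => //; split => /=; last first.
  by move=> i; rewrite mxE /ball /= distrC; exact: Hc.
split => // y /= cy; apply: xe.
apply: (@le_ball _ _ _ (ratr r + ratr r)).
  by rewrite (splitr e) lerD// ltW.
by apply: ball_triangle cy; exact: ball_sym.
Qed.

Lemma measurable_row_of_tuple : measurable_fun setT row_of_tuple.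
Proof.
apply: (@measurability _ _ _ _ _ _ (@open 'rV[R]_d)) => //.
move=> _ [U oU <-]; rewrite setTI (open_rV_bigcup oU) preimage_bigcup.
apply: countable_bigcupT_measurable => [|[c r] /=]; first exact: countableP.
have [cU|cU] := pselect (0 < (ratr r : R) /\
    ball (map_mx ratr c : 'rV[R]_d) (ratr r) `<=` U); last first.
  rewrite (_ : _ @^-1` _ = set0)//.
  by apply/seteqP; split => // t /= -[].
rewrite (_ : _ @^-1` _ = \bigcap_(i in [set: 'I_d])
    ((fun t : d.-tuple (measurableTypeR R) => tnth t i) @^-1`
      ball (ratr (c ord0 i) : R) (ratr r))); last first.
  apply/seteqP; split => [t /= [_ H] i _|t H] /=.
    by have := H i; rewrite mxE.
  by split => // i; rewrite mxE; exact: H.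
apply: fin_bigcap_measurable => // i _.
rewrite -[X in measurable X]setTI; apply: measurable_tnth => //.
exact: measurable_ball.
Qed.

(* Lebesgue measure on R^d; see lebesgue_rV_box. *)
Definition lebesgue_rV : set 'rV[R]_d -> \bar R :=
  pushforward (power_measure (@lebesgue_measure R) d) row_of_tuple.

Hint Resolve measurable_row_of_tuple : core.

Let lebesgue_rV0 : lebesgue_rV set0 = 0%E.
Proof. by rewrite /lebesgue_rV; apply: measure0. Qed.

Let lebesgue_rV_ge0 A : (0 <= lebesgue_rV A)%E.
Proof. by rewrite /lebesgue_rV; apply: measure_ge0. Qed.

Let lebesgue_rV_sigma_additive : semi_sigma_additive lebesgue_rV.
Proof. by rewrite /lebesgue_rV; apply: measure_semi_sigma_additive. Qed.

HB.instance Definition _ := isMeasure.Build _ _ _ lebesgue_rV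
  lebesgue_rV0 lebesgue_rV_ge0 lebesgue_rV_sigma_additive.

Let lebesgue_rV_sigma_finite : sigma_finite setT lebesgue_rV.
Proof.
apply: (pushforward_sigma_finite measurable_tuple_of_row row_of_tupleK).
exact: sigma_finiteT.
Qed.

HB.instance Definition _ := Measure_isSigmaFinite.Build _ _ _ lebesgue_rV
  lebesgue_rV_sigma_finite.

Lemma lebesgue_rV_box (a b : 'I_d -> R) : (forall i, a i <= b i) ->
  lebesgue_rV [set x | forall i, x ord0 i \in `[a i, b i]] =
  (\prod_i (b i - a i))%:E.
Proof.
move=> ab; rewrite /lebesgue_rV /pushforward.
rewrite (_ : _ @^-1` _ =
    [set t | forall i, [set` `[a i, b i]] (tnth t i)]); last first.
  by apply/seteqP; split => t /= H i; have := H i; rewrite mxE.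
have mI i : @measurable _ (measurableTypeR R) [set` `[a i, b i]].
  exact: measurable_itv.
apply: (etrans (power_measure_box (@lebesgue_measure R) mI)).
rewrite -prodEFin; apply: eq_bigr => i _.
rewrite [LHS]lebesgue_measure_itv/= lte_fin; case: ltgtP (ab i) => // ->.
by rewrite subrr.
Qed.

End lebesgue_rV.

Section orthogonal_projection.
Context (R : realType) (d : nat).
Implicit Types (V : {vspace 'rV[R]_d}) (x y : 'rV[R]_d).

Definition dotrV x y : R := (x *m y^T) ord0 ord0.

(* xget picks the unique such y, see orthprojP; 0 is a dummy default. *)
Definition orthproj V x : 'rV[R]_d :=
  xget 0 [set y | y \in V /\ forall v, v \in V -> dotrV (x - y) v = 0].

Lemma dotrV_eq0 x : dotrV x x = 0 -> x = 0.
Proof.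
rewrite /dotrV mxE => /psumr_eq0P H; apply/rowP => i; rewrite mxE.
have {H} : x ord0 i * x^T i ord0 = 0.
  by apply: H => // j _; rewrite mxE -expr2 sqr_ge0.
by rewrite mxE => /eqP; rewrite mulf_eq0 orbb => /eqP.
Qed.

Lemma orthproj_ex V x :
  exists y, y \in V /\ forall v, v \in V -> dotrV (x - y) v = 0.
Proof.
pose B := \matrix_(i < \dim V) (vbasis V)`_i.
pose f : 'Hom('rV[R]_d, 'rV[R]_(\dim V)) := linfun (mulmxr B^T).
have fE (w : 'rV[R]_d) : w \in lker f -> forall v, v \in V -> dotrV w v = 0.
  rewrite memv_ker lfunE/= => /eqP wB v /coord_vbasis ->.
  have ZE (a : R) (u : 'rV[R]_d) : dotrV w (a *: u) = a * dotrV w u.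
    by rewrite /dotrV linearZ/= -scalemxAr mxE.
  have SE (F : 'I_(\dim V) -> 'rV[R]_d) :
      dotrV w (\sum_i F i) = \sum_i dotrV w (F i).
    by rewrite /dotrV linear_sum mulmx_sumr summxE.
  rewrite SE big1// => i _; rewrite ZE.
  have /rowP/(_ i) := wB; rewrite !mxE => wBi.
  rewrite (_ : dotrV _ _ = 0) ?mulr0// -[RHS]wBi /dotrV mxE.
  by apply: eq_bigr => j _; rewrite !mxE.
have VW0 : (V :&: lker f)%VS = 0%VS.
  apply/eqP; rewrite -subv0; apply/subvP => w.
  rewrite memv_cap memv0 => /andP[wV wW].
  by apply/eqP/dotrV_eq0; exact: fE.
have : x \in (V + lker f)%VS.
  suff -> : (V + lker f)%VS = fullv by rewrite memvf.
  apply/eqP; rewrite eqEdim subvf/= (dimv_disjoint_sum VW0).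
  have := limg_ker_dim f fullv; rewrite capfv => <-.
  rewrite addnC leq_add2r (leq_trans (dimvS (subvf _)))//.
  by rewrite dimvf /dim/= mul1n.
by case/memv_addP => y yV [w wW ->]; exists y; split => // v;
  rewrite addrAC subrr add0r; exact: fE.
Qed.

Lemma orthprojP V x :
  orthproj V x \in V /\ forall v, v \in V -> dotrV (x - orthproj V x) v = 0.
Proof. by rewrite /orthproj; case: xgetP => // H; have [y /H] := orthproj_ex V x. Qed.

End orthogonal_projection.

Section fov.
Context (R : realType) (d : nat).
Local Notation X := ('rV[R]_d).
Implicit Types (V : {vspace X}) (S : set X) (D h g : X -> R) (A : {fset X}).

Definition multi_power h A : R := \prod_(a <- A) h a.

Definition inner h g : R := \int[@lebesgue_rV R d]_x (h x * g x).

Definition gen_indic V S (x : X) : R := \1_S (orthproj V x).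

Definition fov_card_cond V S (n : nat) A : R :=
  \sum_(B <- fpowerset A | #|` B| == n)
    multi_power (gen_indic V S) B *
    multi_power (fun x => 1 - gen_indic V S x) (A `\` B)%fset.

(* The finite set {x_1, ..., x_m}: repeated entries are identified, which for
   d > 0 only happens on a set of measure zero in X^m. *)
Definition fset_of_tuple m (xs : m.-tuple X) : {fset X} :=
  [fset x in (xs : seq X)]%fset.

(* The set integral of fov_card_cond V S n * f; the terms m < n vanish, since
   then no subset of an m-element set has n elements. *)
Definition fov_card V S (f : {fset X} -> R) (n : nat) : \bar R :=
  (\sum_(n <= m <oo)
    (m`!%:R^-1)%:E *
    \int[power_measure (@lebesgue_rV R d) m]_xs
      (fov_card_cond V S n (fset_of_tuple xs) * f (fset_of_tuple xs))%:E)%E.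

Definition card_mean D : R := \int[@lebesgue_rV R d]_x D x.

(* The density of a Poisson random finite set with PHD D. *)
Definition poisson_density D A : R := expR (- card_mean D) * multi_power D A.

End fov.

(* Main.v *)
Require Import Defs.
From HB Require Import structures.
From mathcomp Require Import all_boot all_order all_algebra finmap.
From mathcomp Require Import all_classical all_reals all_analysis.
From mathcomp Require Import measurable_realfun ring.

Import Order.TTheory GRing.Theory Num.Theory.
Import numFieldNormedType.Exports.
Local Open Scope classical_set_scope.
Local Open Scope ring_scope.

(* Let P be the set of states whose projection lies in S. Given a finite set X,
   the conditional probability rho_S(n | X) is 0 or 1 according to whether
   exactly n points of X lie in P. So the m-th term of the set integral is,
   up to the factor exp (- N_X) / m!, the integral over m-tuples of
   [exactly n entries lie in P] * prod_i D x_i.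
   Splitting off the first entry (Tonelli) gives
     I(m + 1, n) = <1_P, D> I(m, n - 1) + <1 - 1_P, D> I(m, n),
   hence I(m, n) = C(m, n) <1_P, D>^n <1 - 1_P, D>^(m - n) by Pascal's rule.
   Tuples with repeated entries are harmless because points are null sets. *)

(** * Weighted integrals over tuples, for an atomless sigma-finite measure *)

Section undup_weight.
Context d (T : measurableType d) (R : realType).
Implicit Types (P : set T) (D : T -> R) (n k : nat) (s : seq T).

(* The value at the underlying set of s of [n points lie in P] * [D]^X; working
   with undup s rather than s makes this exact even when s has repetitions. *)
Definition undup_weight P D n s : R :=
  (count (fun x => x \in P) (undup s) == n)%:R * \prod_(x <- undup s) D x.

Lemma undup_weight_ge0 P D n s : (forall x, 0 <= D x) ->
  0 <= undup_weight P D n s.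
Proof. by move=> D0; rewrite mulr_ge0 ?prodr_ge0. Qed.

(** A new point either lies in [P] and uses up one of the [n] places, which is impossible for
    [n = 0], or lies outside and leaves the count alone. A repeated point is discarded by
    [undup]. *)
Lemma undup_weight_cons P D n x s : undup_weight P D n (x :: s) =
  if x \in s then undup_weight P D n s else
    (if n is n'.+1 then \1_P x * D x * undup_weight P D n' s else 0) +
    \1_(~` P) x * D x * undup_weight P D n s.
Proof.
rewrite /undup_weight /=; case: ifPn => // xs.
rewrite /= big_cons !indicE in_setC; case: (x \in P); case: n => [|n] /=;
  rewrite ?add1n ?add0n ?eqSS ?mul1r ?mul0r ?addr0 ?add0r ?mulr1//;
  by rewrite mulrCA mulrA.
Qed.

Hypothesis diagonal_measurable : measurable [set p : T * T | p.1 = p.2].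

(** Membership is a finite union, over the entries, of preimages of the diagonal. *)
Lemma measurable_mem_tuple k :
  measurable [set p : T * k.-tuple T | p.1 \in p.2].
Proof.
rewrite (_ : mkset _ = \bigcup_(i in [set: 'I_k])
    (fun p : T * k.-tuple T => (p.1, tnth p.2 i)) @^-1`
    [set p | p.1 = p.2]); last first.
  apply/seteqP; split => [[x t] /= /tnthP[i xi]|[x t] [i _ /= ->]].
    by exists i.
  exact: mem_tnth.
apply: fin_bigcup_measurable => // i _.
rewrite -[X in measurable X]setTI.
have : measurable_fun setT (fun p : T * k.-tuple T => (p.1, tnth p.2 i)).
  apply: measurable_fun_pair; first exact: measurable_fst.
  by apply: (measurableT_comp (measurable_tnth i)); exact: measurable_snd.
by move=> mp; exact: mp.
Qed.

Lemma measurable_undup_weight P D n k : measurable P ->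
  measurable_fun setT D ->
  measurable_fun setT (fun t : k.-tuple T => undup_weight P D n t).
Proof.
move=> mP mD; elim: k n => [|k IH] n.
  rewrite (_ : (fun t => _) = cst (undup_weight P D n [::])).
    exact: measurable_cst.
  by apply/funext => t; rewrite tuple0.
pose G (p : T * k.-tuple T) := undup_weight P D n (p.1 :: p.2).
rewrite (_ : (fun t => _) = G \o @uncons_tuple _ _ k); last first.
  by apply/funext => t; rewrite /G/= [in LHS](tuple_eta t).
apply: measurableT_comp; last exact: measurable_uncons_tuple.
rewrite /G; under eq_fun do rewrite undup_weight_cons.
have mF j : measurable_fun setT (fun p : T * k.-tuple T => undup_weight P D j p.2).
  by apply: (measurableT_comp (IH j)); exact: measurable_snd.
have mU (A : set T) : measurable A ->
    measurable_fun setT (fun p : T * k.-tuple T => \1_A p.1 * D p.1).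
  move=> mA; apply: (@measurableT_comp _ _ _ _ _ _ (fun x => \1_A x * D x)).
    by apply: measurable_funM => //; exact: measurable_indic.
  exact: measurable_fst.
apply: measurable_fun_ifT => //.
  apply: (@measurable_fun_bool _ _ _ _ true); rewrite setTI.
  exact: measurable_mem_tuple.
apply: measurable_funD.
  case: n {G} => [|n]; first exact: measurable_cst.
  by apply: measurable_funM => //; exact: mU.
by apply: measurable_funM => //; apply: mU; exact: measurableC.
Qed.

Variable m : {sigma_finite_measure set T -> \bar R}.

Lemma power_measure_coord0 k (i : 'I_k) (A : set T) : measurable A ->
  m A = 0%E -> power_measure m k [set t | tnth t i \in A] = 0%E.
Proof.
(* The set is a box constrained in coordinate [i] only. The other factors may be infinite, but
   [0 * +oo = 0] in the extended reals. *)
move=> mA A0; pose B j := if j == i then A else setT.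
have mB j : measurable (B j) by rewrite /B; case: ifP.
rewrite (_ : mkset _ = [set t | forall j, B j (tnth t j)]); last first.
  apply/seteqP; split => t /=.
    by move=> /set_mem tA j; rewrite /B; case: eqP => // ->.
  by move=> /(_ i); rewrite /B eqxx => /mem_set.
by rewrite (power_measure_box m mB) (bigD1 i)//= /B eqxx A0 mul0e.
Qed.

Hypothesis m_atomless : forall x, m [set x] = 0%E.

Lemma measurable_singleton (x : T) : measurable [set x].
Proof.
rewrite (_ : [set x] = xsection [set p : T * T | p.1 = p.2] x).
  exact: measurable_xsection.
by apply/seteqP; split => y; rewrite /xsection /= in_setE /=.
Qed.

(** For fixed [x], the tuples containing [x] form a finite union of sets with one coordinate pinned
    to [x], each null since points are null; integrating over [x] gives zero. *)
Lemma product_measure_mem_tuple0 k :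
  product_measure1 m (power_measure m k)
    [set p : T * k.-tuple T | p.1 \in p.2] = 0%E.
Proof.
rewrite /product_measure1 integral0_eq// => x _ /=.
rewrite (_ : xsection _ x =
    \big[setU/set0]_(i <- enum 'I_k) [set t | tnth t i \in [set x]]); last first.
  rewrite -bigcup_seq; apply/seteqP; split => t.
    rewrite /xsection /= in_setE /= => /tnthP[i xi].
    by exists i; rewrite /= ?mem_enum// in_setE.
  by move=> [i _ /=]; rewrite /xsection /= !in_setE /= => <-; exact: mem_tnth.
have mA (i : 'I_k) : measurable [set t : k.-tuple T | tnth t i \in [set x]].
  rewrite (_ : mkset _ = setT `&` (fun t => tnth t i) @^-1` [set x]).
    by apply: measurable_tnth => //; exact: measurable_singleton.
  by rewrite setTI; apply/seteqP; split => t /=; rewrite in_setE.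
apply: measure_negligible; first exact: bigsetU_measurable.
elim/big_ind : _ => [||i _]; [exact: negligible_set0|exact: negligibleU|].
apply/negligibleP => //; apply: power_measure_coord0 => //.
exact: measurable_singleton.
Qed.

Variables (P : set T) (D : T -> R) (a b : R).
Hypotheses (mP : measurable P) (mD : measurable_fun setT D).
Hypothesis D_ge0 : forall x, 0 <= D x.
Hypothesis intP : (\int[m]_x (\1_P x * D x)%:E = a%:E)%E.
Hypothesis intCP : (\int[m]_x (\1_(~` P) x * D x)%:E = b%:E)%E.

Lemma integral_power_measure_cons k (f : k.+1.-tuple T -> \bar R) :
  measurable_fun setT f -> (forall t, (0 <= f t)%E) ->
  (\int[power_measure m k.+1]_t f t =
   \int[product_measure1 m (power_measure m k)]_p f (Defs.cons_tuple p))%E.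
Proof.
move=> mf f0 /=; rewrite /cons_measure.
by rewrite ge0_integral_pushforward//; exact: measurable_cons_tuple.
Qed.

Lemma integral_product_measureM k (g : T -> R) (h : k.-tuple T -> R) :
  measurable_fun setT g -> measurable_fun setT h ->
  (forall x, 0 <= g x) -> (forall t, 0 <= h t) ->
  (\int[product_measure1 m (power_measure m k)]_p (g p.1 * h p.2)%:E =
   \int[m]_x (g x)%:E * \int[power_measure m k]_t (h t)%:E)%E.
Proof.
move=> mg mh g0 h0.
have I0 : (0 <= \int[power_measure m k]_t (h t)%:E)%E.
  by apply: integral_ge0 => t _; rewrite lee_fin.
rewrite fubini_tonelli1//=; last 2 first.
- apply/measurable_EFinP; apply: measurable_funM.
    by apply: (measurableT_comp mg); exact: measurable_fst.
  by apply: (measurableT_comp mh); exact: measurable_snd.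
- by move=> p; rewrite lee_fin mulr_ge0.
rewrite -ge0_integralZr//; last 2 first.
- exact/measurable_EFinP.
- by move=> x _; rewrite lee_fin.
apply: eq_integral => x _; rewrite /fubini_F /=.
under eq_integral do rewrite EFinM.
rewrite ge0_integralZl// ?lee_fin//; last by move=> t _; rewrite lee_fin.
exact/measurable_EFinP.
Qed.

Lemma integral_undup_weight k n :
  (\int[power_measure m k]_t (undup_weight P D n t)%:E =
   ('C(k, n)%:R * a ^+ n * b ^+ (k - n))%:E)%E.
Proof.
have mU (A : set T) : measurable A -> measurable_fun setT (fun x => \1_A x * D x).
  by move=> mA; apply: measurable_funM => //; exact: measurable_indic.
have U0 (A : set T) x : 0 <= \1_A x * D x by rewrite mulr_ge0// indicE.
have W0 j s : 0 <= undup_weight P D j s by exact: undup_weight_ge0.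
have mW j l := @measurable_undup_weight P D j l mP mD.
elim: k n => [|k IH] n.
  rewrite integral_dirac//=; last by apply/measurable_EFinP; exact: (mW n 0).
  rewrite (_ : dirac _ _ = 1%E); last exact: diracT.
  (* The empty tuple has no point in [P], so both sides are 1 for [n = 0] and 0 otherwise. *)
  rewrite mul1e /undup_weight/= big_nil mulr1 bin0n.
  by case: n => [|n] /=; rewrite ?mul0r// !mul1r.
rewrite integral_power_measure_cons//; last 2 first.
- by apply/measurable_EFinP; exact: (mW n k.+1).
- by move=> t; rewrite lee_fin.
pose F n' (p : T * k.-tuple T) := \1_P p.1 * D p.1 * undup_weight P D n' p.2.
pose G (p : T * k.-tuple T) := \1_(~` P) p.1 * D p.1 * undup_weight P D n p.2.
have mF n' : measurable_fun setT (F n').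
  apply: measurable_funM.
    by apply: (measurableT_comp (mU _ mP)); exact: measurable_fst.
  by apply: (measurableT_comp (mW n' k)); exact: measurable_snd.
have mG : measurable_fun setT G.
  apply: measurable_funM.
    by apply: (measurableT_comp (mU _ (measurableC mP))); exact: measurable_fst.
  by apply: (measurableT_comp (mW n k)); exact: measurable_snd.
have F0 n' p : 0 <= F n' p by rewrite mulr_ge0.
have G0 p : 0 <= G p by rewrite mulr_ge0.
pose H p := (if n is n'.+1 then F n' p else 0) + G p.
have mH : measurable_fun setT H.
  by apply: measurable_funD => //; case: (n) => // ; exact: measurable_cst.
have H0 p : 0 <= H p by rewrite addr_ge0//; case: (n).
(* The integrand agrees with [H] except where the first entry recurs in the tail, and that set is
   null. *)
rewrite (_ : integral _ _ _ =
    \int[product_measure1 m (power_measure m k)]_p (H p)%:E)%E; last first.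
  apply: ge0_ae_eq_integral => //.
  - apply/measurable_EFinP; apply: (measurableT_comp (mW n k.+1)).
    exact: measurable_cons_tuple.
  - exact/measurable_EFinP.
  - by move=> p _; rewrite lee_fin.
  - by move=> p _; rewrite lee_fin.
  exists [set p : T * k.-tuple T | p.1 \in p.2]; split.
  - exact: measurable_mem_tuple.
  - exact: product_measure_mem_tuple0.
  - move=> [x t]; apply: contra_notP => /= /negP xt _.
    by rewrite undup_weight_cons (negbTE xt).
rewrite /H; under eq_integral do rewrite EFinD.
rewrite ge0_integralD//; last 4 first.
- by move=> p _; rewrite lee_fin; case: (n).
- by apply/measurable_EFinP; case: (n) => //; exact: measurable_cst.
- by move=> p _; rewrite lee_fin.
- exact/measurable_EFinP.
have W0k j (t : k.-tuple T) : 0 <= undup_weight P D j t by [].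
rewrite [X in (_ + X)%E](@integral_product_measureM k _ _
  (mU _ (measurableC mP)) (mW n k) (U0 _) (W0k n)).
rewrite intCP IH.
case: n {mG G0 H mH H0 G} => [|n].
  by rewrite integral0 add0e -EFinM !bin0 !subn0 !expr0 exprS !mul1r.
rewrite (@integral_product_measureM k _ _ (mU _ mP) (mW n k) (U0 _) (W0k n)).
rewrite intP IH -!EFinM -EFinD binS natrD subSS; congr EFin.
(* For [n < k] the exponent [k - n] is the successor of [k - n.+1]. For [k <= n] truncated
   subtraction breaks this relation, but then ['C(k, n.+1)] vanishes. *)
have [nk|kn] := ltnP n k.
  by rewrite -subnSK// !exprS; ring.
by rewrite (@bin_small k n.+1)// exprS; ring.
Qed.
End undup_weight.

Arguments undup_weight {d T R}.

(** * Orthogonal projection, measurability and null points in R^d *)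

Section row_vectors.
Context (R : realType) (d : nat).
Implicit Types (V : {vspace 'rV[R]_d}) (x y : 'rV[R]_d) (S : set 'rV[R]_d).

Lemma dotrVBl x y z : dotrV (x - y) z = dotrV x z - dotrV y z.
Proof. by rewrite /dotrV mulmxBl !mxE. Qed.

(** The difference of two candidates lies in [V] and is orthogonal to [V], hence to itself, so it is
    zero. *)
Lemma orthproj_unique V x y : y \in V ->
  (forall v, v \in V -> dotrV (x - y) v = 0) -> orthproj V x = y.
Proof.
move=> yV xy; have [pV xp] := orthprojP V x.
have dV : orthproj V x - y \in V by rewrite rpredB.
apply/eqP; rewrite -subr_eq0; apply/eqP/dotrV_eq0.
rewrite -[X in dotrV X _](_ : (x - y) - (x - orthproj V x) = _).
  by rewrite dotrVBl xy// xp// subrr.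
by rewrite opprB addrC addrA subrK.
Qed.

Lemma orthproj_linear V : linear (orthproj V).
Proof.
move=> a x y; have [pV xp] := orthprojP V x; have [qV yq] := orthprojP V y.
apply: orthproj_unique => [|v vV]; first by rewrite rpredD// rpredZ.
rewrite opprD addrACA -scalerBr /dotrV mulmxDl mxE -scalemxAl mxE.
by rewrite -!/(dotrV _ _) xp// yq// mulr0 addr0.
Qed.

Lemma measurable_coord_rV (i : 'I_d) :
  measurable_fun setT (fun x : 'rV[R]_d => x ord0 i).
Proof.
rewrite (_ : (fun x => _) = (fun t => tnth t i) \o @tuple_of_row R d).
  by apply: measurableT_comp; [exact: measurable_tnth|exact: measurable_tuple_of_row].
by apply/funext => x /=; rewrite tnth_mktuple.
Qed.

(** Factoring [f] through tuples passes from the Borel sigma-algebra to the product one, where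
    measurability is coordinatewise. *)
Lemma measurable_fun_rV d' (T : measurableType d') (f : T -> 'rV[R]_d) :
  (forall i, measurable_fun setT (fun t => f t ord0 i)) -> measurable_fun setT f.
Proof.
move=> mf; rewrite (_ : f = @row_of_tuple R d \o (@tuple_of_row R d \o f)).
  apply: measurableT_comp; first exact: measurable_row_of_tuple.
  apply/measurable_fun_tnthP => i.
  apply: (eq_measurable_fun (fun t => f t ord0 i)) => // t _.
  by rewrite /= tnth_mktuple.
by apply/funext => x; apply/rowP => i; rewrite /= mxE tnth_mktuple.
Qed.

Lemma measurable_orthproj V : measurable_fun setT (orthproj V).
Proof.
pose p : {linear 'rV[R]_d -> 'rV[R]_d} := HB.pack (orthproj V)
  (GRing.isLinear.Build _ _ _ _ _ (orthproj_linear V)).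
apply: measurable_fun_rV => i.
(* By linearity each coordinate of the projection is a finite linear combination of the coordinates
   of [x]. *)
rewrite (_ : (fun x => _) =
    fun x => \sum_j x ord0 j * p (delta_mx 0 j) ord0 i); last first.
  apply/funext => x; rewrite -[orthproj V x]/(p x) {1}[x]row_sum_delta.
  rewrite linear_sum summxE; apply: eq_bigr => j _.
  by rewrite linearZ mxE.
apply: measurable_sum => j; apply: measurable_funM; last exact: measurable_cst.
exact: measurable_coord_rV.
Qed.

Lemma compact_measurable_rV S : compact S -> measurable S.
Proof.
move=> /(compact_closed (@norm_hausdorff _ _)) /closed_openC oS.
by rewrite -[S]setCK; apply: measurableC; exact: sub_sigma_algebra.
Qed.

Lemma measurable_diagonal_rV :
  measurable [set p : 'rV[R]_d * 'rV[R]_d | p.1 = p.2].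
Proof.
rewrite (_ : mkset _ = \bigcap_(i in [set: 'I_d])
    (fun p : 'rV[R]_d * 'rV[R]_d => p.1 ord0 i == p.2 ord0 i) @^-1` [set true]).
  apply: fin_bigcap_measurable => // i _; rewrite -[X in measurable X]setTI.
  apply: measurable_fun_eqr => //.
    by apply: (measurableT_comp (measurable_coord_rV i)); exact: measurable_fst.
  by apply: (measurableT_comp (measurable_coord_rV i)); exact: measurable_snd.
apply/seteqP; split => [[x y] /= -> i _ /=|[x y] /= xy]; first exact: eqxx.
by apply/rowP => i; apply/eqP; exact: xy.
Qed.

(** A point is a degenerate box. Positive dimension supplies a zero side length; in dimension 0 the
    empty product would be 1. *)
Lemma lebesgue_rV_set1 x : (0 < d)%N -> @lebesgue_rV R d [set x] = 0%E.
Proof.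
move=> d0; rewrite (_ : [set x] =
    [set y | forall i, y ord0 i \in `[x ord0 i, x ord0 i]]).
  by rewrite lebesgue_rV_box// (bigD1 (Ordinal d0))//= subrr mul0r.
apply/seteqP; split => [y /= -> i|y /= yx]; first by rewrite in_itv/= lexx.
by apply/rowP => i; apply/eqP; rewrite eq_le andbC; have := yx i; rewrite in_itv.
Qed.

End row_vectors.

(** * The conditional cardinality distribution as a 0-1 count *)

Section multi_power.
Context (R : realType) (d : nat).
Implicit Types (V : {vspace 'rV[R]_d}) (S : set 'rV[R]_d) (A B : {fset 'rV[R]_d}).

Lemma multi_power_bool (p : pred 'rV[R]_d) A :
  multi_power (fun x => (p x)%:R) A = (all p A)%:R :> R.
Proof.
rewrite /multi_power; elim: (enum_fset A) => [|x s IH]; first by rewrite big_nil.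
by rewrite big_cons IH /=; case: (p x); rewrite ?mul1r ?mul0r.
Qed.

(** A summand is nonzero only if every point of [B] projects into [S] and no point of [A] outside
    [B] does. This forces [B] to be the set [C] of all points of [A] that project into [S], so the
    sum tests whether [C] has [n] elements. *)
Lemma fov_card_condE V S n A :
  fov_card_cond V S n A =
  (count (fun x => x \in orthproj V @^-1` S) A == n)%:R :> R.
Proof.
pose p x := x \in orthproj V @^-1` S; pose C := [fset x in A | p x]%fset.
have gE : gen_indic V S = fun x => (p x)%:R :> R.
  by apply/funext => x; rewrite /gen_indic indicE /p.
have gCE : (fun x => 1 - gen_indic V S x) = fun x => (~~ p x)%:R :> R.
  by apply/funext => x; rewrite gE; case: (p x); rewrite ?subrr ?subr0.
rewrite -[count _ _]/(count p A); clearbody p.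
have CA : (C `<=` A)%fset by apply/fsubsetP => x; rewrite !inE => /andP[].
have cardC : #|` C| = count p A.
  rewrite -size_filter; apply: perm_size; apply: uniq_perm.
  - exact: fset_uniq.
  - by rewrite filter_uniq// fset_uniq.
  - by move=> x; rewrite mem_filter !inE andbC.
have wE B : B \in fpowerset A ->
    multi_power (gen_indic V S) B *
    multi_power (fun x => 1 - gen_indic V S x) (A `\` B)%fset = (B == C)%:R.
  rewrite fpowersetE gCE gE !multi_power_bool => BA.
  rewrite -natrM mulnb; congr (nat_of_bool _)%:R.
  apply/andP/eqP => [[/allP pB /allP pAB]|->]; last first.
    split; apply/allP => x; first by rewrite !inE => /andP[].
    by rewrite !inE; case: (p x); rewrite ?andbF // andbT andNb.
  apply/fsetP => x; rewrite !inE.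
  have [xB|xB] := boolP (x \in B).
    by rewrite (fsubsetP BA)//= pB.
  have [xA|//] := boolP (x \in A); apply/esym/negbTE/pAB.
  by rewrite !inE xA xB.
rewrite /fov_card_cond big_seq_cond.
under eq_bigr => B /andP[BA _] do rewrite wE//.
rewrite -big_seq_cond -cardC.
have [Cn|Cn] := eqVneq #|` C| n.
  rewrite big_mkcond (bigD1_seq C)/= ?fpowersetE ?fset_uniq// Cn !eqxx big1 ?addr0//.
  by move=> B /negbTE ->; case: ifP.
rewrite big1// => B /eqP Bn; case: eqP => // BC.
by rewrite -Bn BC eqxx in Cn.
Qed.

(** The finite set underlying [t] enumerates [undup t] up to permutation, so counts and products
    agree even when [t] has repetitions. *)
Lemma fov_card_cond_poissonE V S (D : 'rV[R]_d -> R) n m (t : m.-tuple 'rV[R]_d) :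
  fov_card_cond V S n (fset_of_tuple t) * poisson_density D (fset_of_tuple t) =
  expR (- card_mean D) * undup_weight (orthproj V @^-1` S) D n t.
Proof.
have tE : perm_eq (fset_of_tuple t) (undup t).
  apply: uniq_perm; [exact: fset_uniq|exact: undup_uniq|move=> x].
  by rewrite mem_undup !inE.
rewrite fov_card_condE (permP tE) /poisson_density /multi_power.
by rewrite (perm_big _ tE) mulrCA.
Qed.

End multi_power.

(** * Finite inner products and the termwise comparison of the two series *)

Lemma inner_indic_EFin (R : realType) (d : nat) (P : set 'rV[R]_d)
    (D : 'rV[R]_d -> R) : measurable P ->
  (@lebesgue_rV R d).-integrable setT (EFin \o D) ->
  (\int[@lebesgue_rV R d]_x (\1_P x * D x)%:E = (inner \1_P D)%:E)%E.
Proof.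
move=> mP iD; have mD : measurable_fun setT D.
  by apply/measurable_EFinP; case/integrableP: iD.
rewrite /inner /Rintegral fineK//.
(* [inner] is a real-valued integral, so it matches the extended one only when that is finite;
   domination by [D] ensures this. *)
apply: integrable_fin_num => //; apply: le_integrable iD => //.
  by apply/measurable_EFinP; apply: measurable_funM => //; exact: measurable_indic.
move=> x _ /=; rewrite lee_fin indicE normrM.
by case: (x \in P); rewrite ?normr1 ?mul1r// normr0 mul0r.
Qed.

Theorem proposition1 (R : realType) (d : nat) (d_gt0 : (0 < d)%N)
    (Xp : {vspace 'rV[R]_d}) (S : set 'rV[R]_d)
    (S_compact : compact S) (S_sub : S `<=` [set x | x \in Xp])
    (D : 'rV[R]_d -> R) (D_ge0 : forall x, 0 <= D x)
    (D_integrable : (@lebesgue_rV R d).-integrable setT (EFin \o D))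
    (n : nat) :
  fov_card Xp S (poisson_density D) n =
  (\sum_(n <= m <oo)
    (expR (- card_mean D) / (n`! * (m - n)`!)%:R *
     inner (gen_indic Xp S) D ^+ n *
     inner (fun x => 1 - gen_indic Xp S x)%R D ^+ (m - n))%:E)%E.
Proof.
pose P := orthproj Xp @^-1` S.
have mP : measurable P.
  rewrite -[P]setTI; apply: measurable_orthproj => //.
  exact: compact_measurable_rV.
have mD : measurable_fun setT D.
  by apply/measurable_EFinP; case/integrableP: D_integrable.
have gE : gen_indic Xp S = \1_P by [].
have gCE : (fun x => 1 - gen_indic Xp S x) = \1_(~` P).
  by apply/funext => x; rewrite gE !indicE in_setC; case: (x \in P);
    rewrite ?subrr ?subr0.
rewrite gE gCE /fov_card; congr (limn _); apply/funext => N.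
apply: eq_big_nat => m /andP[nm _].
under eq_integral do rewrite fov_card_cond_poissonE EFinM.
rewrite ge0_integralZl// ?lee_fin ?expR_ge0//; last 2 first.
- apply/measurable_EFinP; apply: measurable_undup_weight => //.
  exact: measurable_diagonal_rV.
- by move=> t _; rewrite lee_fin undup_weight_ge0.
rewrite (@integral_undup_weight _ _ _ (@measurable_diagonal_rV R d) _
  (fun x => @lebesgue_rV_set1 R d x d_gt0) _ _ _ _ mP mD D_ge0
  (inner_indic_EFin _ _ _ _ mP D_integrable)
  (inner_indic_EFin _ _ _ _ (measurableC mP) D_integrable)).
rewrite -!EFinM; congr EFin.
(* As [n <= m], [m!] factors as ['C(m, n) * n! * (m - n)!], so the prefactor [1 / m!] cancels the
   binomial coefficient. *)
have /(congr1 (fun k => k%:R : R)) := bin_fact nm; rewrite !natrM => <-.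
have f0 k : k`!%:R != 0 :> R by rewrite pnatr_eq0 -lt0n fact_gt0.
have c0 : 'C(m, n)%:R != 0 :> R by rewrite pnatr_eq0 -lt0n bin_gt0.
by field; rewrite !f0 c0.
Qed.
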